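(* There is an absolute constant $\lambda<30$ (not depending on $k$, $h$, or the candidates) with the following property. Let $k\ge 1$ and $1\le h\le k$ be integers with $h$ dividing $k$, and let $\mathcal{S}$ be a finite set of at least $k$ mutually independent candidates. Let $\{X_1,\dots,X_k\}\subseteq\mathcal{S}$ be any $k$-element subset of top scorers for the test $f_h$, i.e. $f_h(X_i)\ge f_h(Z)$ for every $i$ and every $Z\in\mathcal{S}\setminus\{X_1,\dots,X_k\}$, and let $\{Y_1,\dots,Y_k\}\subseteq\mathcal{S}$ be a $k$-element subset maximizing $g_h$ among all $k$-element subsets of $\mathcal{S}$. Then $$g_h(Y_1,\dots,Y_k)\le \lambda\, g_h(X_1,\dots,X_k).$$
   Context: A candidate is a nonnegative discrete random variable $X$ taking finitely many positive values $x_1>x_2>\dots>x_n$ with probabilities $p_1,\dots,p_n$ (where $\sum_i p_i\le 1$) and the value $0$ with the remaining probability. For candidates $X_1,\dots,X_k$ and $1\le h\le k$, $g_h(X_1,\dots,X_k)=\mathbb{E}\big(X^{(1)}+\dots+X^{(h)}\big)$, where $X^{(i)}$ denotes the $i$-th largest of $X_1,\dots,X_k$ (the expected sum of the $h$ largest values). The test $f_h(X)=\mathbb{E}\big(\max(X^{[1]},\dots,X^{[k/h]})\big)$, where $X^{[1]},\dots,X^{[k/h]}$ are $k/h$ independent copies of $X$. *)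

(* Defs.v *)
From HB Require Import structures.
From mathcomp Require Import all_boot all_order all_algebra.
From mathcomp Require Import all_classical all_reals all_analysis.

Set Implicit Arguments.
Unset Strict Implicit.
Unset Printing Implicit Defensive.

Import Order.TTheory GRing.Theory Num.Theory.

Local Open Scope classical_set_scope.
Local Open Scope ring_scope.

Section power_probability.
Context (d : measure_display) (T : measurableType d) (R : realType)
  (P : probability T R).

Definition tuple_cons n (x : T * n.-tuple T) : n.+1.-tuple T :=
  [tuple of x.1 :: x.2].

Lemma measurable_tuple_cons n : measurable_fun setT (@tuple_cons n).
Proof. exact: measurable_cons measurable_fst measurable_snd. Qed.

HB.instance Definition _ n :=
  isMeasurableFun.Build _ _ _ _ (@tuple_cons n) (@measurable_tuple_cons n).

(* The product probability P (x) ... (x) P on n.-tuple T: under it the         *)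
(* coordinates are n independent points of law P (power_probability_box), so   *)
(* for a random variable X on T the maps t |-> X (tnth t j) are n independent  *)
(* copies of X.                                                                *)
Fixpoint power_probability (n : nat) : probability (n.-tuple T) R :=
  if n is n'.+1 then
    distribution (P \x power_probability n')%E (@tuple_cons n')
  else \d_([tuple] : 0.-tuple T).

Lemma power_probability_box n (A : 'I_n -> set T) :
  (forall j, measurable (A j)) ->
  power_probability n [set t | forall j, A j (tnth t j)] =
  (\prod_(j < n) P (A j))%E.
Proof.
elim: n A => [|n IH] A mA.
  by rewrite big_ord0 /= diracE mem_set//= => -[].
rewrite big_ord_recl -IH//= /distribution /pushforward /=.
rewrite [X in product_measure1 _ _ X](_ : _ = A ord0 `*`
    [set t : n.-tuple T | forall j, A (lift ord0 j) (tnth t j)]); last first.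
  apply/seteqP; split => [[x t] /= H|[x t] [/= H0 H] j].
    by split=> [|j]; [exact: (H ord0)|have := H (lift ord0 j); rewrite tnthS].
  by case: (unliftP ord0 j) => [i|] ->; rewrite ?tnthS.
rewrite product_measure1E//.
rewrite [X in measurable X](_ : _ =
  \bigcap_(j in setT) ((@tnth n T)^~ j @^-1` A (lift ord0 j))); last first.
  by apply/seteqP; split=> [t H j _|t H j]; exact: H.
apply: fin_bigcap_measurable => // j _.
by rewrite -[X in measurable X]setTI; apply: measurable_tnth.
Qed.

End power_probability.

Section candidates.
Context (d : measure_display) (T : measurableType d) (R : realType)
  (P : probability T R).

Definition candidate (X : {RV P >-> R}) : Prop :=
  (forall w, 0 <= X w) /\ finite_set (range X).

Definition mutually_independent (I : finType) (X : I -> {RV P >-> R}) : Prop :=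
  forall (J : {set I}) (A : I -> set R), (forall i, measurable (A i)) ->
    P (\bigcap_(i in [set` J]) (X i @^-1` A i)) =
    (\prod_(i in J) P (X i @^-1` A i))%E.

(* The neutral element 0 does not change the maximum when 1 <= m and X is      *)
(* nonnegative.                                                                *)
Definition expected_max (m : nat) (X : {RV P >-> R}) : \bar R :=
  'E_(power_probability P m)[fun t => \big[Num.max/0]_(j < m) X (tnth t j)].

Definition test_score (k h : nat) (X : {RV P >-> R}) : \bar R :=
  expected_max (k %/ h) X.

(* Numbered from 0: order_statistic X C 0 is the largest of the X i, i in C.   *)
Definition order_statistic (I : finType) (X : I -> {RV P >-> R}) (C : {set I})
    (j : nat) (w : T) : R :=
  nth 0 (sort >=%R [seq X i w | i <- enum C]) j.

Definition expected_top (I : finType) (X : I -> {RV P >-> R}) (h : nat)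
    (C : {set I}) : \bar R :=
  'E_P[fun w => \sum_(j < h) order_statistic X C j w].

End candidates.

(* Main.v *)
(* Write m = k/h, a_t(Z) = E (Z - t)^+, and let theta be the largest score of a
   candidate outside X.  For independent candidates with r = P(all are <= t),
     t (1 - r) + r * (sum of the a_t) <= E max <= t + (sum of the a_t).
   The upper bound on m copies of a candidate of X gives m a_t >= theta - t; for
   t = theta / 2 the lower bound on a group of m members of X then gives
   E max >= theta / 2, and h disjoint groups yield g_h(X) >= h theta / 2.
   For Z outside X and t > theta, the lower bound on m copies of Z forces r > 0
   and m a_t(Z) <= t.  Since the h largest values of Y sum to at most those of X
   plus h t plus the excesses over t of Y \ X, we get g_h(Y) <= g_h(X) + 2 h t;
   letting t tend to theta, g_h(Y) <= 5 g_h(X). *)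
Require Import Defs.
From HB Require Import structures.
From mathcomp Require Import all_boot all_order all_algebra.
From mathcomp Require Import all_classical all_reals all_analysis.
From mathcomp Require Import measurable_realfun.
From mathcomp Require Import ring lra.

Set Implicit Arguments.
Unset Strict Implicit.
Unset Printing Implicit Defensive.

Import Order.TTheory GRing.Theory Num.Theory.

Local Open Scope ring_scope.

(** * Pointwise inequalities for the sum of the h largest of finitely many reals *)

Section top_sum.
Context (R : realType) (I : finType).
Implicit Types (x : I -> R) (C D G : {set I}) (h : nat) (t : R).

(** At a fixed sample point this is the integrand of [expected_top]. The default 0 of [nth] pads the
    list when [C] has fewer than [h] elements. *)
Definition top_sum x h C : R :=
  \sum_(j < h) nth 0 (sort >=%R [seq x i | i <- enum C]) j.

(** Sorting indices instead of values lets a set of indices be read off, even when values tie. *)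
Let desc x C := sort (relpre x >=%R) (enum C).

Let mem_desc x C i : (i \in desc x C) = (i \in C).
Proof. by rewrite mem_sort mem_enum. Qed.

Let desc_uniq x C : uniq (desc x C).
Proof. by rewrite sort_uniq enum_uniq. Qed.

Let top_sum_take x h C : top_sum x h C = \sum_(i <- take h (desc x C)) x i.
Proof.
rewrite /top_sum sort_map -/(desc x C).
rewrite -(big_map x xpredT id) map_take; set s := map _ _.
elim: h s => [|h IH] s; first by rewrite big_ord0 take0 big_nil.
case: s => [|a s] /=.
  by rewrite big_nil big1// => i _; rewrite nth_nil.
by rewrite big_ord_recl big_cons /= -IH.
Qed.

Lemma top_sum_witness x h C :
  exists D, [/\ D \subset C, (#|D| <= h)%N & top_sum x h C = \sum_(i in D) x i].
Proof.
have us : uniq (take h (desc x C)) by rewrite take_uniq.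
exists [set i in take h (desc x C)]; split.
- by apply/fintype.subsetP => i; rewrite inE => /mem_take; rewrite mem_desc.
- by rewrite cardsE; move/card_uniqP : us => ->; rewrite size_take_min geq_minl.
- rewrite top_sum_take big_uniq//=.
  by apply: eq_bigl => i; rewrite inE.
Qed.

(** Each value is at most [t] plus its excess over [t]; at most [h] thresholds are paid, and the
    excesses added outside [D] are nonnegative. *)
Lemma sum_le_excess x D C h t : D \subset C -> (#|D| <= h)%N -> 0 <= t ->
  \sum_(i in D) x i <= h%:R * t + \sum_(i in C) Num.max 0 (x i - t).
Proof.
move=> DC Dh t0.
apply: (@le_trans _ _ (\sum_(i in D) (t + Num.max 0 (x i - t)))).
  by apply: ler_sum => i _; rewrite -lerBlDl le_max lexx orbT.
rewrite big_split /= sumr_const -[t *+ _]mulr_natl lerD//.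
  by rewrite ler_wpM2r// ler_nat.
rewrite [leRHS](big_setID D) /= (finset.setIidPr DC) ler_wpDr// sumr_ge0// => i _.
by rewrite le_max lexx.
Qed.

(* With the threshold [t] at the (h+1)-st largest value, [sum_le_excess] is
   attained by the top h values. *)
Lemma sum_le_top_sum x D C h : (forall i, 0 <= x i) -> D \subset C ->
  (#|D| <= h)%N -> \sum_(i in D) x i <= top_sum x h C.
Proof.
move=> x0 DC Dh; set s := desc x C.
pose t := nth 0 (map x s) h.
have t0 : 0 <= t.
  rewrite /t; have [hs|hs] := ltnP h (size (map x s)); last by rewrite nth_default.
  by have /mapP[i _ ->] := mem_nth 0 hs.
apply: le_trans (sum_le_excess x DC Dh t0) _.
have -> : \sum_(i in C) Num.max 0 (x i - t) = \sum_(i <- s) Num.max 0 (x i - t).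
  rewrite [RHS]big_uniq ?desc_uniq//.
  by apply: eq_bigl => i; rewrite mem_desc.
rewrite top_sum_take -/s -{1}(cat_take_drop h s) big_cat /=.
have ss : sorted >=%R (map x s).
  by rewrite sorted_map; apply: sort_sorted => a b; exact: le_total.
have nth_ge a b : (a <= b)%N -> (b < size s)%N ->
    nth 0 (map x s) b <= nth 0 (map x s) a.
  move=> ab bs; apply: (sorted_leq_nth ge_trans ge_refl 0 ss) => //.
    by rewrite inE size_map (leq_ltn_trans ab).
  by rewrite inE size_map.
(* If [C] has at most [h] elements, the default value makes [t] equal 0 and the bound is the sum
   over all of [C]. *)
have [hs|hs] := leqP (size s) h.
  rewrite drop_oversize// take_oversize// big_nil addr0.
  rewrite /t nth_default ?size_map// mulr0 add0r.
  by apply: ler_sum => i _; rewrite subr0 ge_max x0 lexx.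
have -> : \sum_(i <- drop h s) Num.max 0 (x i - t) = 0.
  rewrite big_seq big1// => i /(nthP i)[j]; rewrite size_drop nth_drop => jl <-.
  apply/max_idPl; rewrite subr_le0 /t.
  have hj : (h + j < size s)%N by rewrite -ltn_subRL.
  rewrite -(nth_map i 0)//.
  by apply: nth_ge; rewrite ?leq_addr.
rewrite addr0.
rewrite (_ : h%:R * t = \sum_(i <- take h s) t); last first.
  by rewrite big_const_seq count_predT size_takel ?(ltnW hs)// iter_addr_0 mulr_natl.
rewrite -big_split /= big_seq [leRHS]big_seq; apply: ler_sum => i /(nthP i)[j].
rewrite size_takel ?(ltnW hs)// => jh; rewrite nth_take// => <-.
have -> : Num.max 0 (x (nth i s j) - t) = x (nth i s j) - t.
  apply/max_idPr; rewrite subr_ge0 /t.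
  rewrite -(nth_map i 0) ?(ltn_trans jh)//.
  by apply: nth_ge => //; exact: ltnW.
lra.
Qed.

(** A finite maximum of sums is visibly measurable and nonnegative, which the sorted form is not. *)
Lemma top_sum_bigmax x h C : (forall i, 0 <= x i) ->
  top_sum x h C =
  \big[Num.max/0]_(D : {set I} | (D \subset C) && (#|D| <= h)%N) \sum_(i in D) x i.
Proof.
move=> x0; apply/eqP; rewrite eq_le; apply/andP; split; last first.
  apply: bigmax_le => [|D /andP[]]; last exact: sum_le_top_sum.
  (* The empty set gives the nonnegativity demanded by the base value 0 of the maximum. *)
  have := @sum_le_top_sum x finset.set0 C h x0.
  by rewrite big_set0; apply; rewrite ?finset.sub0set ?cards0.
have [D [DC Dh ->]] := top_sum_witness x h C.
by apply: (le_bigmax_cond _ (fun D : {set I} => \sum_(i in D) x i)); rewrite DC.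
Qed.

Lemma top_sum_ge0 x h C : (forall i, 0 <= x i) -> 0 <= top_sum x h C.
Proof. by move=> x0; rewrite top_sum_bigmax// bigmax_ge_id. Qed.

(** Split an optimal set [E] for [C] along [D]: the part inside [D] competes for the top sum of [D],
    and the part outside is bounded by [sum_le_excess]. *)
Lemma top_sum_le_excess x h C D t : (forall i, 0 <= x i) -> 0 <= t ->
  top_sum x h C <=
  top_sum x h D + (h%:R * t + \sum_(i in C :\: D) Num.max 0 (x i - t)).
Proof.
move=> x0 t0; have [E [EC Eh ->]] := top_sum_witness x h C.
rewrite (big_setID D) /=; apply: lerD.
  apply: sum_le_top_sum => //; first exact: finset.subsetIr.
  by rewrite (leq_trans _ Eh)// subset_leq_card// finset.subsetIl.
apply: sum_le_excess => //; first exact: finset.setSD.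
by rewrite (leq_trans _ Eh)// subset_leq_card// subsetDl.
Qed.

(** Choose in each group an index attaining its maximum; disjointness makes these [h] indices
    distinct, so they form an admissible subset of [C]. *)
Lemma sum_bigmax_le_top_sum x h C (G : 'I_h -> {set I}) : (forall i, 0 <= x i) ->
  (forall j, G j \subset C) -> (forall j, G j != finset.set0) ->
  (forall j j', j != j' -> [disjoint G j & G j']) ->
  \sum_(j < h) \big[Num.max/0]_(i in G j) x i <= top_sum x h C.
Proof.
move=> x0 GC G0 Gdisj.
have /choice[a Pa] j : exists i, i \in G j /\ \big[Num.max/0]_(i in G j) x i = x i.
  have /set0Pn[i iG] := G0 j.
  by have [i0 ? ->] := @eq_bigmax _ _ _ 0 i (mem (G j)) x iG (fun i _ => x0 i); exists i0.
have aG j : a j \in G j by have [] := Pa j.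
have ainj : injective a.
  move=> j j' e; apply/eqP/negP => /negP /Gdisj /disjointFr /(_ (aG j)).
  by rewrite e aG.
rewrite (eq_bigr (fun j => x (a j))); last by move=> j _; have [] := Pa j.
rewrite -(big_imset x (h := a) (A := mem 'I_h)); last by move=> ? ? _ _; exact: ainj.
apply: sum_le_top_sum => //; last by rewrite card_imset// card_ord.
by apply/fintype.subsetP => _ /imsetP[j _ ->]; exact: (fintype.subsetP (GC j)).
Qed.

Lemma bigmax_le_excess x t G : 0 <= t ->
  \big[Num.max/0]_(i in G) x i <= t + \sum_(i in G) Num.max 0 (x i - t).
Proof.
move=> t0; apply: bigmax_le => [|i iG].
  by rewrite addr_ge0// sumr_ge0// => i _; rewrite le_max lexx.
rewrite -lerBlDl (bigD1 i)//= ler_wpDr ?le_max ?lexx ?orbT//.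
by rewrite sumr_ge0// => j _; rewrite le_max lexx.
Qed.

(* At most one summand is nonzero, and only when the maximum exceeds [t]. *)
Lemma excess_le_bigmax x t G : 0 <= t ->
  t * (~~ [forall j in G, x j <= t])%:R +
  \sum_(i in G) Num.max 0 (x i - t) * [forall j in G :\ i, x j <= t]%:R <=
  \big[Num.max/0]_(i in G) x i.
Proof.
move=> t0; have [/forall_inP all_le|] := boolP [forall j in G, x j <= t].
  rewrite mulr0 add0r big1 ?bigmax_ge_id// => i iG.
  by rewrite (max_idPl _) ?mul0r// subr_le0 all_le.
rewrite negb_forall_in => /exists_inP[i iG]; rewrite -ltNge => ti.
rewrite mulr1 (bigD1 i)//= [X in _ + (_ + X)]big1 => [|j /andP[jG ji]].
  rewrite addr0 -lerBrDl; apply: (@le_trans _ _ (x i - t)).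
    rewrite (max_idPr _) ?subr_ge0 ?(ltW ti)// ler_piMr ?subr_ge0 ?(ltW ti)//.
    by case: [forall _ in _, _]; rewrite ?ler01.
  by rewrite lerB// le_bigmax_cond.
case: forall_inP => [/(_ i)|]; last by rewrite mulr0.
by rewrite !inE eq_sym ji iG => /(_ isT); rewrite leNgt ti.
Qed.

End top_sum.

Local Open Scope classical_set_scope.
Local Open Scope ring_scope.

(** * Expectation calculus for nonnegative measurable functions *)

Section expectation_of_nonnegative_functions.
Context (d : measure_display) (T : measurableType d) (R : realType)
  (P : probability T R).
Implicit Types (f g : T -> R).

Lemma measurable_bigmax (I : Type) (s : seq I) (Q : pred I) (f : I -> T -> R) :
  (forall i, measurable_fun setT (f i)) ->
  measurable_fun setT (fun w => \big[Num.max/0]_(i <- s | Q i) f i w).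
Proof.
move=> mf; elim: s => [|i s IH].
  by under eq_fun do rewrite big_nil; exact: measurable_cst.
under eq_fun do rewrite big_cons; case: (Q i) => //.
exact: measurable_maxr.
Qed.

Lemma measurable_sum_cond (I : Type) (s : seq I) (Q : pred I) (f : I -> T -> R) :
  (forall i, measurable_fun setT (f i)) ->
  measurable_fun setT (fun w => \sum_(i <- s | Q i) f i w).
Proof. by move=> mf; under eq_fun do rewrite -big_filter; exact: measurable_sum. Qed.

Lemma ge0_expectation_le f g :
  measurable_fun setT f -> measurable_fun setT g ->
  (forall w, 0 <= f w) -> (forall w, f w <= g w) -> ('E_P[f] <= 'E_P[g])%E.
Proof.
move=> mf mg f0 fg; apply: expectation_le => //; last exact: aeW.
by move=> w; exact: le_trans (fg w).
Qed.

Lemma ge0_expectationD f g :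
  measurable_fun setT f -> measurable_fun setT g ->
  (forall w, 0 <= f w) -> (forall w, 0 <= g w) ->
  'E_P[(fun w => f w + g w)%R]%E = ('E_P[f] + 'E_P[g])%E.
Proof.
move=> mf mg f0 g0; rewrite unlock -ge0_integralD//.
- by move=> w _; rewrite lee_fin.
- exact/measurable_EFinP.
- by move=> w _; rewrite lee_fin.
- exact/measurable_EFinP.
Qed.

Lemma ge0_expectation_sum (I : Type) (s : seq I) (Q : pred I) (f : I -> T -> R) :
  (forall i, measurable_fun setT (f i)) -> (forall i w, 0 <= f i w) ->
  'E_P[(fun w => \sum_(i <- s | Q i) f i w)%R]%E = (\sum_(i <- s | Q i) 'E_P[f i])%E.
Proof.
move=> mf f0; rewrite unlock; under eq_integral do rewrite -big_filter -sumEFin.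
rewrite ge0_integral_sum//=; first by rewrite big_filter.
  by move=> i; exact/measurable_EFinP.
by move=> i w _; rewrite lee_fin.
Qed.

Lemma ge0_expectationZl f c : measurable_fun setT f -> (forall w, 0 <= f w) ->
  0 <= c -> 'E_P[(fun w => c * f w)%R]%E = (c%:E * 'E_P[f])%E.
Proof.
move=> mf f0 c0; rewrite unlock.
under eq_integral do rewrite EFinM.
rewrite ge0_integralZl_EFin//; last exact/measurable_EFinP.
by move=> w _; rewrite lee_fin.
Qed.

End expectation_of_nonnegative_functions.

(** * Finitely valued random variables and their mean excess over a threshold *)

Section finite_valued.
Context (d : measure_display) (T : measurableType d) (R : realType)
  (P : probability T R).
Implicit Types (X : {RV P >-> R}) (phi : R -> R) (t : R).

Lemma candidate_values X : candidate X ->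
  exists2 s : seq R, uniq s & forall w, X w \in s.
Proof.
move=> [_ /finite_seqP[s Xs]]; exists (undup s); first exact: undup_uniq.
by move=> w; rewrite mem_undup; have : range X (X w) by []; rewrite Xs.
Qed.

Lemma measurable_level X (v : R) : measurable (X @^-1` [set v]).
Proof. exact: measurable_funPTI. Qed.

(** The indicator of [B] lets one formula serve plain expectations, with [B] the whole space, and
    expectations restricted to an independent event. *)
Lemma finite_valued_expectation X phi (s : seq R) (B : set T) :
  measurable B -> (forall v, 0 <= phi v) -> uniq s -> (forall w, X w \in s) ->
  'E_P[(fun w => phi (X w) * \1_B w)%R]%E =
  (\sum_(v <- s) (phi v)%:E * P (X @^-1` [set v] `&` B))%E.
Proof.
move=> mB phi0 us Xs.
have mXB v : measurable (X @^-1` [set v] `&` B).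
  by apply: measurableI => //; exact: measurable_level.
(* At each [w] only the summand [v = X w] survives. *)
have -> : (fun w => phi (X w) * \1_B w) =
    (fun w => \sum_(v <- s) phi v * \1_(X @^-1` [set v] `&` B) w).
  apply/funext => w; rewrite (bigD1_seq (X w))//= big1 => [|v vX].
    rewrite addr0 !indicE in_setI.
    by have -> : w \in X @^-1` [set X w] by exact/mem_set.
  rewrite indicE in_setI [X in X && _](_ : _ = false) ?mulr0//.
  by apply/negbTE; rewrite notin_setE /= => e; rewrite e eqxx in vX.
rewrite ge0_expectation_sum.
- apply: eq_bigr => v _; rewrite ge0_expectationZl ?expectation_indic//.
- by move=> v; apply: measurable_funM.
- by move=> v w; rewrite mulr_ge0.
Qed.

Lemma expectation_setT f : ('E_P[(fun w => f w * \1_[set: T] w)%R] = 'E_P[f])%E.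
Proof. by congr expectation; apply/funext => w; rewrite indicT mulr1. Qed.

Lemma candidate_expectation_fin_num X phi : candidate X ->
  (forall v, 0 <= phi v) -> 'E_P[(fun w => phi (X w))%R]%E \is a fin_num.
Proof.
move=> /candidate_values[s us Xs] phi0; rewrite -expectation_setT.
rewrite (finite_valued_expectation _ phi0 us Xs)//.
apply/sum_fin_numP => v _ _.
by rewrite fin_numM// fin_num_measure//; rewrite setIT; exact: measurable_level.
Qed.

(** As [X] has finitely many values, independence of [B] from each level set suffices to factor term
    by term. *)
Lemma candidate_expectation_indep X phi (B : set T) : candidate X ->
  (forall v, 0 <= phi v) -> measurable B ->
  (forall v, P (X @^-1` [set v] `&` B) = P (X @^-1` [set v]) * P B)%E ->
  'E_P[(fun w => phi (X w) * \1_B w)%R]%E = ('E_P[(fun w => phi (X w))%R] * P B)%E.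
Proof.
move=> /candidate_values[s us Xs] phi0 mB XB.
rewrite -(expectation_setT (fun w => phi (X w))).
rewrite !(finite_valued_expectation _ phi0 us Xs)//.
rewrite ge0_sume_distrl; last by move=> v _; apply: mule_ge0; rewrite ?lee_fin.
by apply: eq_bigr => v _; rewrite XB setIT muleA.
Qed.

(** The quantity a_t; for a candidate the expectation is finite, so [fine] loses nothing
    ([mean_excessE]). *)
Definition mean_excess X t : R := fine 'E_P[(fun w => Num.max 0 (X w - t))%R]%E.

Lemma mean_excessE X t : candidate X ->
  'E_P[(fun w => Num.max 0 (X w - t))%R]%E = (mean_excess X t)%:E.
Proof.
move=> cX; rewrite /mean_excess fineK//.
apply: (candidate_expectation_fin_num (phi := fun v => Num.max 0 (v - t))) => //.
by move=> v; rewrite le_max lexx.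
Qed.

Lemma measurable_excess X t :
  measurable_fun setT (fun w => Num.max 0 (X w - t)).
Proof. by apply: measurable_maxr => //; exact: measurable_funB. Qed.

Lemma excess_ge0 X t w : 0 <= Num.max 0 (X w - t).
Proof. by rewrite le_max lexx. Qed.

Lemma mean_excess_ge0 X t : 0 <= mean_excess X t.
Proof. by apply/fine_ge0/expectation_ge0 => w; exact: excess_ge0. Qed.

End finite_valued.

(** Two probability spaces are allowed because the copies of a candidate live on a product space.
    The range condition lets one list of values serve both expectations. *)
Lemma mean_excess_eq_law (d d' : measure_display) (T : measurableType d)
    (T' : measurableType d') (R : realType) (P : probability T R)
    (Q : probability T' R) (X : {RV P >-> R}) (Y : {RV Q >-> R}) (t : R) :
  candidate X -> (forall w, range X (Y w)) ->
  (forall v, P (X @^-1` [set v]) = Q (Y @^-1` [set v])) ->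
  mean_excess X t = mean_excess Y t.
Proof.
move=> /candidate_values[s us Xs] XY law; congr fine.
have Ys w : Y w \in s by have [v _ <-] := XY w.
have phi0 (v : R) : 0 <= Num.max 0 (v - t) by rewrite le_max lexx.
rewrite -[LHS]expectation_setT -[RHS]expectation_setT.
rewrite (finite_valued_expectation measurableT phi0 us Xs).
rewrite (finite_valued_expectation measurableT phi0 us Ys).
by apply: eq_bigr => v _; rewrite !setIT law.
Qed.

(** * Upper and lower bounds on the expected maximum of candidates *)

Section expected_maximum.
Context (d : measure_display) (T : measurableType d) (R : realType)
  (P : probability T R) (I : finType) (X : I -> {RV P >-> R}).
Implicit Types (G : {set I}) (t : R).

Hypothesis candX : forall i, candidate (X i).

Lemma expected_max_le_excess G t : 0 <= t ->
  ('E_P[(fun w => \big[Num.max/0]_(i in G) X i w)%R] <=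
   (t + \sum_(i in G) mean_excess (X i) t)%:E)%E.
Proof.
move=> t0.
apply: (@le_trans _ _ ('E_P[(fun w => t + \sum_(i in G) Num.max 0 (X i w - t))%R])%E).
  apply: ge0_expectation_le.
  - exact: measurable_bigmax.
  - apply: measurable_funD => //.
    by apply: measurable_sum_cond => i; exact: measurable_excess.
  - by move=> w; exact: bigmax_ge_id.
  - by move=> w; exact: bigmax_le_excess.
rewrite (@ge0_expectationD _ _ _ _ (cst t)) => //; last 2 first.
- by apply: measurable_sum_cond => i; exact: measurable_excess.
- by move=> w; rewrite sumr_ge0// => i _; exact: excess_ge0.
rewrite expectation_cst ge0_expectation_sum; last 2 first.
- by move=> i; exact: measurable_excess.
- by move=> i w; exact: excess_ge0.
by under eq_bigr do rewrite mean_excessE//; rewrite sumEFin.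
Qed.

Hypothesis indepX : mutually_independent X.

Let low G t := \bigcap_(j in [set` G]) (X j @^-1` [set x | x <= t]).

Let measurable_low G t : measurable (low G t).
Proof.
apply: fin_bigcap_measurable => // j _.
by apply: measurable_funPTI; rewrite -set_itvNyc; exact: measurable_itv.
Qed.

Let mem_low G t w : (w \in low G t) = [forall j in G, X j w <= t].
Proof.
apply/idP/forall_inP.
  by rewrite inE => H j jG; exact: H.
by move=> H; rewrite inE => j jG; exact: H.
Qed.

Let indep_low G t i v : i \in G ->
  (P (X i @^-1` [set v] `&` low (G :\ i) t) =
   P (X i @^-1` [set v]) * P (low (G :\ i) t))%E.
Proof.
(* Independence over [G] with this family and independence over [G :\ i] give the same product. *)
move=> iG; pose A j : set R := if j == i then [set v] else [set x | x <= t].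
have mle : measurable [set x : R | x <= t].
  by rewrite -set_itvNyc; exact: measurable_itv.
have mA j : measurable (A j) by rewrite /A; case: ifP.
rewrite [X in P X](_ : _ = \bigcap_(j in [set` G]) (X j @^-1` A j)).
  rewrite indepX// (bigD1 i)//= {1}/A eqxx; congr (_ * _)%E.
  rewrite /low indepX//; apply: eq_big => [j|j /andP[_ /negPf ji]].
    by rewrite !inE andbC.
  by rewrite /A ji.
apply/seteqP; split => w.
  move=> [/= Xv Xt] j /= jG; rewrite /A; have [->//|ji] := eqVneq j i.
  by apply: Xt; rewrite /= !inE ji.
move=> H; split; first by have := H i iG; rewrite /A eqxx.
move=> j /=; rewrite !inE => /andP[/negPf ji jG].
by have := H j jG; rewrite /A ji.
Qed.

(** Integrate [excess_le_bigmax], with [r] the probability that all of [G] stay at or below [t].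
    Independence factors each summand into a mean excess times the probability that the other
    members stay low. *)
Lemma excess_le_expected_max G t : 0 <= t ->
  exists2 r : R, 0 <= r <= 1 &
  ((t * (1 - r) + r * \sum_(i in G) mean_excess (X i) t)%:E <=
   'E_P[(fun w => \big[Num.max/0]_(i in G) X i w)%R])%E.
Proof.
move=> t0; have Plow_fin H : P (low H t) \is a fin_num.
  by rewrite fin_num_measure//; exact: measurable_low.
pose r := fine (P (low G t)).
have Pr : P (low G t) = r%:E by rewrite /r fineK.
exists r; first by rewrite -!lee_fin -Pr measure_ge0 probability_le1.
have m1 H : measurable_fun setT (\1_(low H t) : T -> R).
  by apply: measurable_indic; exact: measurable_low.
have mE i : measurable_fun setT
    (fun w => Num.max 0 (X i w - t) * \1_(low (G :\ i) t) w).
  by apply: measurable_funM => //; exact: measurable_excess.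
have E0 i w : 0 <= Num.max 0 (X i w - t) * \1_(low (G :\ i) t) w.
  by rewrite mulr_ge0 ?excess_ge0.
apply: (@le_trans _ _ ('E_P[(fun w => t * \1_(~` low G t) w +
    \sum_(i in G) Num.max 0 (X i w - t) * \1_(low (G :\ i) t) w)%R])%E); last first.
  apply: ge0_expectation_le.
  - apply: measurable_funD; last exact: measurable_sum_cond.
    apply: measurable_funM => //; apply: measurable_indic.
    exact/measurableC/measurable_low.
  - exact: measurable_bigmax.
  - by move=> w; rewrite addr_ge0 ?sumr_ge0// mulr_ge0.
  - move=> w; apply: le_trans (excess_le_bigmax (fun i => X i w) G t0).
    rewrite indicE in_setC mem_low lerD//.
    by apply: ler_sum => i _; rewrite indicE mem_low.
have mlowC : measurable (~` low G t) by exact/measurableC/measurable_low.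
rewrite (@ge0_expectationD _ _ _ _ (fun w => t * \1_(~` low G t) w)); last 4 first.
- by apply: measurable_funM => //; exact: measurable_indic.
- exact: measurable_sum_cond.
- by move=> w; rewrite mulr_ge0.
- by move=> w; rewrite sumr_ge0.
rewrite ge0_expectationZl//.
rewrite expectation_indic// probability_setC ?Pr; last exact: measurable_low.
rewrite ge0_expectation_sum// EFinD EFinM leeD// mulr_sumr -sumEFin.
apply: lee_sum => i iG.
have -> : ('E_P[(fun w => Num.max 0 (X i w - t) * \1_(low (G :\ i) t) w)%R] =
    (mean_excess (X i) t)%:E * P (low (G :\ i) t))%E.
  rewrite -mean_excessE//.
  apply: (candidate_expectation_indep (phi := fun v => Num.max 0 (v - t))) => // v.
    by rewrite le_max lexx.
  exact: indep_low.
rewrite EFinM muleC lee_wpmul2l ?lee_fin ?mean_excess_ge0//.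
(* Dropping the constraint on [i] enlarges the event, so its probability is at least [r]. *)
rewrite -Pr le_measure ?inE//; [exact: measurable_low..|].
by move=> w H j /=; rewrite !inE => /andP[_ jG]; exact: H.
Qed.

End expected_maximum.

(** * Independent copies on the product space, and what a score says about the mean excess *)

Section independent_copies.
Context (d : measure_display) (T : measurableType d) (R : realType)
  (P : probability T R) (X : {RV P >-> R}) (m : nat).

Definition copy (j : 'I_m) (w : m.-tuple T) : R := X (tnth w j).

Lemma measurable_copy j : measurable_fun setT (copy j).
Proof. exact: measurableT_comp (measurable_tnth j). Qed.

HB.instance Definition _ j :=
  isMeasurableFun.Build _ _ _ _ (copy j) (measurable_copy j).

Definition copy_rv j : {RV (power_probability P m) >-> R} := copy j.

Lemma copy_law j (A : set R) : measurable A ->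
  power_probability P m (copy_rv j @^-1` A) = P (X @^-1` A).
Proof.
move=> mA; pose B i : set T := if i == j then X @^-1` A else setT.
rewrite (_ : _ @^-1` _ = [set w | forall i, B i (tnth w i)]).
  rewrite power_probability_box; last first.
    by move=> i; rewrite /B; case: ifP => // _; exact: measurable_funPTI.
  rewrite (bigD1 j)//= /B eqxx big1 ?mule1// => i /negPf ->.
  exact: probability_setT.
apply/seteqP; split => w /=; last by move=> /(_ j); rewrite /B eqxx.
by move=> H i; rewrite /B; case: eqP => [->|].
Qed.

(** Putting the whole space at coordinates outside [J] turns the event into a box, whose probability
    is a product. *)
Lemma copy_mutually_independent : mutually_independent copy_rv.
Proof.
move=> J A mA; pose B i : set T := if i \in J then X @^-1` A i else setT.
rewrite (_ : \bigcap_(_ in _) _ = [set w | forall i, B i (tnth w i)]).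
  rewrite power_probability_box; last first.
    by move=> i; rewrite /B; case: ifP => // _; exact: measurable_funPTI.
  rewrite (bigID (mem J))/= [X in (_ * X)%E]big1 => [|i /negPf].
    by rewrite mule1; apply: eq_bigr => i iJ; rewrite /B iJ copy_law.
  by rewrite /B => ->; exact: probability_setT.
apply/seteqP; split => w /=.
  by move=> H i; rewrite /B; case: ifP => // iJ; exact: (H i).
by move=> H i /= iJ; have := H i; rewrite /B iJ.
Qed.

Hypothesis candX : candidate X.

Lemma copy_candidate j : candidate (copy_rv j).
Proof.
have [X0 finX] := candX; split; first by move=> w; exact: X0.
by apply: sub_finite_set finX => _ [w _ <-]; exists (tnth w j).
Qed.

Lemma copy_mean_excess j t : mean_excess (copy_rv j) t = mean_excess X t.
Proof.
apply/esym/mean_excess_eq_law => [//|w|v]; first by exists (tnth w j).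
by rewrite copy_law.
Qed.

Lemma expected_maxE : expected_max m X =
  ('E_(power_probability P m)[(fun w =>
     \big[Num.max/0]_(j in [set: 'I_m]%SET) copy_rv j w)%R])%E.
Proof.
congr expectation; apply/funext => w.
by apply: eq_bigl => j; rewrite inE.
Qed.

Lemma sum_copy_mean_excess t :
  \sum_(j in [set: 'I_m]%SET) mean_excess (copy_rv j) t = m%:R * mean_excess X t.
Proof.
under eq_bigr do rewrite copy_mean_excess.
by rewrite sumr_const cardsT card_ord mulr_natl.
Qed.

Lemma expected_max_fin_num : expected_max m X \is a fin_num.
Proof.
rewrite ge0_fin_numE.
  rewrite expected_maxE.
  by apply: le_lt_trans (expected_max_le_excess copy_candidate _ (lexx 0)) (ltry _).
by apply: expectation_ge0 => w; exact: bigmax_ge_id.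
Qed.

Lemma mean_excess_ge theta t : (theta%:E <= expected_max m X)%E -> 0 <= t ->
  theta - t <= m%:R * mean_excess X t.
Proof.
move=> thetaX t0; rewrite lerBlDl -lee_fin (le_trans thetaX)//.
rewrite expected_maxE -sum_copy_mean_excess.
exact: (expected_max_le_excess copy_candidate _ t0).
Qed.

(** The lower bound on the maximum of the copies reads t (1 - r) + r m a_t <= theta < t; cancel t
    and divide by r. *)
Lemma mean_excess_le theta t : (expected_max m X <= theta%:E)%E ->
  0 <= theta -> theta < t -> m%:R * mean_excess X t <= t.
Proof.
move=> Xtheta theta0 thetat; have t0 : 0 < t by exact: le_lt_trans thetat.
have [r /andP[r0 r1]] := excess_le_expected_max copy_candidate
  copy_mutually_independent [set: 'I_m]%SET (ltW t0).
rewrite -expected_maxE sum_copy_mean_excess => /le_trans/(_ Xtheta).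
rewrite lee_fin; set a := _ * mean_excess X t => H {Xtheta}.
(* With r = 0 the bound would read t <= theta, against the strict inequality. *)
have r_gt0 : 0 < r by rewrite lt_neqAle r0 andbT; apply/eqP => e; rewrite -e in H; lra.
by rewrite -(ler_pM2l r_gt0); lra.
Qed.

End independent_copies.

Local Close Scope classical_set_scope.

(** * Disjoint groups and bounds on g_h *)

Lemma equipartition (I : finType) (C : {set I}) (h m : nat) : #|C| = (h * m)%N ->
  exists G : 'I_h -> {set I}, [/\ forall j, G j \subset C,
    forall j, #|G j| = m & forall j j', j != j' -> [disjoint G j & G j']].
Proof.
move=> Chm; have card_hm : #|{: 'I_h * 'I_m}| = #|C| by rewrite card_prod !card_ord.
(* Elements of [C] are labelled by pairs (group, position); a group is the image of one row. *)
pose e p := enum_val (cast_ord card_hm (enum_rank p)).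
have einj : injective e.
  by move=> p q /enum_val_inj /cast_ord_inj /enum_rank_inj.
exists (fun j => [set e (j, l) | l : 'I_m]); split=> [j|j|j j' jj'].
- by apply/fintype.subsetP => _ /imsetP[l _ ->]; exact: enum_valP.
- by rewrite card_imset ?card_ord// => l l' /einj[].
- apply/pred0P => i /=; apply/negbTE/negP => /andP[].
  move=> /imsetP[l _ ->] /imsetP[l' _ /einj[]] /eqP.
  by rewrite (negPf jj').
Qed.

Section expected_top.
Context (d : measure_display) (T : measurableType d) (R : realType)
  (P : probability T R) (I : finType) (S : I -> {RV P >-> R}).
Hypothesis candS : forall i, candidate (S i).
Implicit Types (C D G : {set I}) (h m : nat) (theta t : R).

Let S_ge0 w i : 0 <= S i w. Proof. by have [->] := candS i. Qed.

Let expected_topE h C : expected_top S h C = ('E_P[(fun w => top_sum (S^~ w) h C)%R])%E.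
Proof. by []. Qed.

Lemma measurable_top_sum h C : measurable_fun setT (fun w => top_sum (S^~ w) h C).
Proof.
under eq_fun => w do rewrite (top_sum_bigmax _ _ (S_ge0 w)).
by apply: measurable_bigmax => D; exact: measurable_sum_cond.
Qed.

Lemma expected_top_le_excess h C D t : 0 <= t ->
  (expected_top S h C <= expected_top S h D +
   (h%:R * t + \sum_(i in C :\: D) mean_excess (S i) t)%:E)%E.
Proof.
move=> t0; have mex : measurable_fun setT
    (fun w => \sum_(i in C :\: D) Num.max 0 (S i w - t)).
  by apply: measurable_sum_cond => i; exact: measurable_excess.
have ex0 w : 0 <= \sum_(i in C :\: D) Num.max 0 (S i w - t).
  by rewrite sumr_ge0// => i _; exact: excess_ge0.
rewrite !expected_topE.
apply: (@le_trans _ _ ('E_P[(fun w => top_sum (S^~ w) h D +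
    (h%:R * t + \sum_(i in C :\: D) Num.max 0 (S i w - t)))%R])%E).
  apply: ge0_expectation_le.
  - exact: measurable_top_sum.
  - apply: measurable_funD; first exact: measurable_top_sum.
    exact: measurable_funD.
  - by move=> w; exact: top_sum_ge0.
  - by move=> w; exact: top_sum_le_excess.
rewrite ge0_expectationD; last 4 first.
- exact: measurable_top_sum.
- exact: measurable_funD.
- by move=> w; exact: top_sum_ge0.
- by move=> w; rewrite addr_ge0// mulr_ge0.
rewrite leeD// (@ge0_expectationD _ _ _ _ (cst (h%:R * t)))//; last first.
  by move=> w; rewrite mulr_ge0.
rewrite expectation_cst ge0_expectation_sum; last 2 first.
- by move=> i; exact: measurable_excess.
- by move=> i w; exact: excess_ge0.
by under eq_bigr do rewrite mean_excessE//; rewrite sumEFin.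
Qed.

Hypothesis indepS : mutually_independent S.

Lemma expected_group_max_ge G m theta : (0 < m)%N -> #|G| = m -> 0 <= theta ->
  (forall i, i \in G -> (theta%:E <= expected_max m (S i))%E) ->
  ((theta / 2)%:E <= 'E_P[(fun w => \big[Num.max/0]_(i in G) S i w)%R])%E.
Proof.
move=> m0 Gm theta0 Gtheta.
have t0 : 0 <= theta / 2 by lra.
have [r /andP[r0 r1]] := excess_le_expected_max candS indepS G t0.
apply: le_trans; rewrite lee_fin.
(* The lower bound is then an average, with weights 1 - r and r, of two numbers that are at least
   theta / 2. *)
suff : theta / 2 <= \sum_(i in G) mean_excess (S i) (theta / 2).
  by move=> /(ler_wpM2l r0); lra.
rewrite -(ler_pM2l (x := m%:R)) ?ltr0n// mulr_sumr.
rewrite -{1}Gm mulr_natl -sumr_const; apply: ler_sum => i iG.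
by apply: le_trans (mean_excess_ge (candS i) (Gtheta i iG) t0); lra.
Qed.

Lemma expected_top_ge C h m theta : (0 < m)%N -> #|C| = (h * m)%N -> 0 <= theta ->
  (forall i, i \in C -> (theta%:E <= expected_max m (S i))%E) ->
  ((h%:R * (theta / 2))%:E <= expected_top S h C)%E.
Proof.
move=> m0 Chm theta0 Ctheta; have [G [GC Gm Gdisj]] := equipartition Chm.
have mmax j : measurable_fun setT (fun w => \big[Num.max/0]_(i in G j) S i w).
  exact: measurable_bigmax.
apply: (@le_trans _ _
    ('E_P[(fun w => \sum_(j < h) \big[Num.max/0]_(i in G j) S i w)%R])%E).
  rewrite ge0_expectation_sum//; last by move=> j w; exact: bigmax_ge_id.
  rewrite mulr_natl -[X in _ *+ X]card_ord -sumr_const -sumEFin.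
  apply: lee_sum => j _; apply: (expected_group_max_ge m0) => // i iG.
  exact/Ctheta/(fintype.subsetP (GC j)).
rewrite expected_topE; apply: ge0_expectation_le.
- exact: measurable_sum_cond.
- exact: measurable_top_sum.
- by move=> w; rewrite sumr_ge0// => j _; exact: bigmax_ge_id.
- move=> w; apply: (sum_bigmax_le_top_sum (S_ge0 w)) => // j.
  by rewrite -card_gt0 Gm.
Qed.

End expected_top.

(** * Comparison of the optimal choice with the top scorers through the best score left out *)

Theorem theorem2p11 (R : realType) :
  exists2 lambda : R, lambda < 30 &
  forall (k h : nat), (1 <= k)%N -> (1 <= h <= k)%N -> (h %| k)%N ->
  forall (d : measure_display) (T : measurableType d) (P : probability T R)
    (I : finType) (S : I -> {RV P >-> R}),
    (k <= #|I|)%N ->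
    (forall i : I, candidate (S i)) ->
    mutually_independent S ->
  forall X Y : {set I},
    #|X| = k ->
    (forall i z : I, i \in X -> z \notin X ->
      (test_score k h (S z) <= test_score k h (S i))%E) ->
    #|Y| = k ->
    (forall C : {set I}, #|C| = k ->
      (expected_top S h C <= expected_top S h Y)%E) ->
    (expected_top S h Y <= lambda%:E * expected_top S h X)%E.
Proof.
(* 5 = 1 + 4: g_h(Y) exceeds g_h(X) by at most 2 h theta, which is 4 times the lower bound h theta /
   2 on g_h(X). *)
exists 5; first lra.
move=> k h k1 /andP[h1 hk] hdvk d T P I S _ candS indepS X Y Xk XZ Yk _.
pose m := (k %/ h)%N; have khm : k = (h * m)%N by rewrite mulnC divnK.
have m0 : (0 < m)%N by rewrite divn_gt0.
pose f i := fine (expected_max m (S i)).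
have fE i : expected_max m (S i) = (f i)%:E by rewrite fineK ?expected_max_fin_num.
have f0 i : 0 <= f i.
  by apply/fine_ge0/expectation_ge0 => w; exact: bigmax_ge_id.
(* The base value 0 covers the case where [X] is the whole family. *)
pose theta := \big[Num.max/0]_(z | z \notin X) f z.
have theta0 : 0 <= theta by exact: bigmax_ge_id.
have gX : ((h%:R * (theta / 2))%:E <= expected_top S h X)%E.
  apply: (expected_top_ge candS indepS m0) => //; first by rewrite Xk.
  move=> i iX; rewrite fE lee_fin; apply: bigmax_le => // z zX.
  by rewrite -lee_fin -!fE; exact: XZ.
have gX0 : (0 <= expected_top S h X)%E.
  by apply: le_trans gX; rewrite lee_fin mulr_ge0// divr_ge0.
have gY t : theta < t ->
    (expected_top S h Y <= expected_top S h X + (2 * h%:R * t)%:E)%E.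
  move=> thetat; have t0 : 0 < t by exact: le_lt_trans thetat.
  apply: le_trans (expected_top_le_excess candS h Y X (ltW t0)) _.
  rewrite leeD// lee_fin (_ : 2 * h%:R * t = h%:R * t + h%:R * t); last by ring.
  rewrite lerD//.
  rewrite -(ler_pM2l (x := m%:R)) ?ltr0n// mulr_sumr.
  (* Each of the at most k = h m indices in [Y :\: X] has m a_t <= t, so m times the total excess is
     at most m h t. *)
  apply: (@le_trans _ _ (\sum_(i in Y :\: X) t)).
    apply: ler_sum => i; rewrite inE => /andP[iX _].
    apply: (mean_excess_le (candS i) _ theta0 thetat).
    by rewrite fE lee_fin (le_bigmax_cond _ f).
  rewrite sumr_const -[leLHS]mulr_natl mulrA -natrM mulnC -khm -Yk.
  by rewrite ler_wpM2r ?(ltW t0)// ler_nat subset_leq_card// subsetDl.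
have gYX : (expected_top S h Y <= expected_top S h X + (2 * h%:R * theta)%:E)%E.
  apply/lee_addgt0Pr => e e0.
  have h2 : 0 < 2 * h%:R :> R by rewrite mulr_gt0// ltr0n.
  (* [gY] needs t > theta; this t costs exactly the margin [e]. *)
  apply: le_trans (gY (theta + e / (2 * h%:R)) _) _.
    by rewrite ltrDl divr_gt0.
  rewrite -addeA leeD// -EFinD lee_fin mulrDr lerD//.
  by rewrite mulrC divfK// gt_eqF.
apply: (le_trans gYX).
rewrite (_ : 5 = 1 + 4); last lra.
rewrite EFinD ge0_muleDl ?lee_fin// mul1e leeD//.
rewrite (_ : 2 * h%:R * theta = 4 * (h%:R * (theta / 2))); last lra.
by rewrite EFinM lee_wpmul2l// lee_fin.
Qed.
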